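(* Let $z^*$ be a local optimal solution of the mathematical program with switching constraints (MPSC) $$\min f(z)\quad\text{s.t.}\quad g(z)\le 0,\ h(z)=0,\ G_i(z)H_i(z)=0,\ i=1,\dots,m.$$ (1) If the generalized Guignard constraint qualification (GGCQ) holds at $z^*$, then $z^*$ is $\mathcal Q$-stationary with respect to every pair $(\beta_1,\beta_2)\in\mathcal P(\mathcal I_{GH}^* )$. (2) Conversely, if $z^*$ is $\mathcal Q$-stationary with respect to some pair $(\beta_1,\beta_2)\in\mathcal P(\mathcal I_{GH}^* )$ such that every $\mu=(\mu^g,\mu^h,\mu^G,\mu^H)\in\mathcal N_{SC}$ satisfies $$\mu_i^G\mu_{i'}^G=0,\quad \mu_i^H\mu_{i'}^H=0\qquad\forall (i,i')\in\beta_1\times\beta_2,$$ $$\mu_i^G\mu_{i'}^H=0\qquad\forall (i,i')\in\beta_1\times\beta_1,$$ $$\mu_i^G\mu_{i'}^H=0\qquad\forall (i,i')\in\beta_2\times\beta_2,$$ then $z^*$ is S-stationary.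
   Context: Setting: $f:\mathbb R^n\to\mathbb R$, $g:\mathbb R^n\to\mathbb R^p$, $h:\mathbb R^n\to\mathbb R^q$, and $G_i,H_i:\mathbb R^n\to\mathbb R$ ($i=1,\dots,m$) are continuously differentiable; gradients are column vectors. $\mathcal F$ is the feasible region of MPSC. Index sets at $z^*\in\mathcal F$: $\mathcal I_g^*=\{i: g_i(z^* )=0\}$; $\mathcal I_G^*=\{i: G_i(z^* )=0,H_i(z^* )\ne0\}$; $\mathcal I_H^*=\{i: G_i(z^* )\neq0,H_i(z^* )=0\}$; $\mathcal I_{GH}^*=\{i: G_i(z^* )=H_i(z^* )=0\}$. $\mathcal P(\mathcal I_{GH}^* )$ is the set of all pairs $(\beta_1,\beta_2)$ of disjoint (possibly empty) sets with $\beta_1\cup\beta_2=\mathcal I_{GH}^*$. Linearization cone: $L_{\mathcal F}^{\rm lin}(z^* )$ is the set of $d\in\mathbb R^n$ with $\nabla g_i(z^* )^Td\le0$ ($i\in\mathcal I_g^*$), $\nabla h_j(z^* )^Td=0$ ($j=1,\dots,q$), $\nabla G_i(z^* )^Td=0$ ($i\in\mathcal I_G^*$), $\nabla H_i(z^* )^Td=0$ ($i\in\mathcal I_H^*$), $(\nabla G_i(z^* )^Td)(\nabla H_i(z^* )^Td)=0$ ($i\in\mathcal I_{GH}^*$). GGCQ at $z^*$: $\widehat N_{\mathcal F}(z^* )=(L_{\mathcal F}^{\rm lin}(z^* ))^\circ$, where $\widehat N_{\mathcal F}(z^* )=\{\zeta: \langle\zeta,z-z^*\rangle\le o(\|z-z^*\|)\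 \forall z\in\mathcal F\}$ is the Fréchet (regular) normal cone and $C^\circ=\{x: x^Ty\le0\ \forall y\in C\}$ is the polar cone. Multiplier sets: $\mathcal R_{SC}$ is the set of $(\mu^g,\mu^h,\mu^G,\mu^H)\in\mathbb R^p\times\mathbb R^q\times\mathbb R^m\times\mathbb R^m$ with $\mu_i^g=0$ for $i\notin\mathcal I_g^*$, $\mu_i^G=0$ for $i\in\mathcal I_H^*$, $\mu_i^H=0$ for $i\in\mathcal I_G^*$. $\mathcal N_{SC}$ is the set of $(\mu^g,\mu^h,\mu^G,\mu^H)\in\mathcal R_{SC}$ with $$\sum_{i=1}^p\mu_i^g\nabla g_i(z^* )+\sum_{i=1}^q\mu_i^h\nabla h_i(z^* )+\sum_{i=1}^m(\mu_i^G\nabla G_i(z^* )+\mu_i^H\nabla H_i(z^* ))=0.$$ $\mathcal Q$-stationarity: $z^*\in\mathcal F$ is $\mathcal Q$-stationary with respect to $(\beta_1,\beta_2)\in\mathcal P(\mathcal I_{GH}^* )$ if there exist $(\lambda^g,\lambda^h,\lambda^G,\lambda^H)\in\mathcal R_{SC}$ with $$0=\nabla f(z^* )+\sum_{i=1}^p\lambda_i^g\nabla g_i(z^* )+\sum_{i=1}^q\lambda_i^h\nabla h_i(z^* )+\sum_{i=1}^m(\lambda_i^G\nabla G_i(z^* )+\lambda_i^H\nabla H_i(z^* ))$$ and $(\mu^g,\mu^h,\mu^G,\mu^H)\in\mathcal N_{SC}$ such that $\lambda_i^g\ge\max\{\mu_i^g,0\}$ for $i\in\mathcal I_g^*$; $\lambda_i^H=0$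 and $\lambda_i^G=\mu_i^G$ for $i\in\beta_1$; $\lambda_i^G=0$ and $\lambda_i^H=\mu_i^H$ for $i\in\beta_2$. S-stationarity: $z^*\in\mathcal F$ is S-stationary if there exist $(\lambda^g,\lambda^h,\lambda^G,\lambda^H)$ with $$\nabla f(z^* )+\sum_{i\in\mathcal I_g^*}\lambda^g_i\nabla g_i(z^* )+\sum_{i=1}^q\lambda^h_i\nabla h_i(z^* )+\sum_{i=1}^m(\lambda^G_i\nabla G_i(z^* )+\lambda^H_i\nabla H_i(z^* ))=0,$$ $\lambda_i^g\ge0$ ($i\in\mathcal I_g^*$), $\lambda_i^G=0$ ($i\in\mathcal I_H^*$), $\lambda_i^H=0$ ($i\in\mathcal I_G^*$), and $\lambda_i^G=\lambda_i^H=0$ ($i\in\mathcal I_{GH}^*$). *)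

(* Defs.v *)
From mathcomp Require Export all_boot all_order all_algebra.
From mathcomp Require Export all_classical all_reals all_analysis.
Export Order.TTheory GRing.Theory Num.Theory.
Export numFieldNormedType.Exports.

Set Implicit Arguments.
Unset Strict Implicit.
Unset Printing Implicit Defensive.

Local Open Scope classical_set_scope.
Local Open Scope ring_scope.

Section Euclidean.
Context {R : realType} {n : nat}.
Implicit Types (x y z zs : 'cV[R]_n) (C F : set 'cV[R]_n).

Definition dot x y : R := (x^T *m y) 0 0.

(* The library norm on 'cV[R]_n is the max norm; it induces the same topology,
   which is the one used for neighbourhoods, continuity and differentiability. *)
Definition enorm x : R := Num.sqrt (dot x x).

Definition gradient (phi : 'cV[R]_n -> R) z : 'cV[R]_n :=
  \col_i 'D_(delta_mx i 0) phi z.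

Definition C1 (phi : 'cV[R]_n -> R) : Prop :=
  (forall z, differentiable phi z) /\ continuous (gradient phi).

Definition polar C : set 'cV[R]_n := [set x | forall y, C y -> dot x y <= 0].

(* <zeta, z - zs> <= o(|z - zs|) for z in F. *)
Definition frechet_normal F zs : set 'cV[R]_n :=
  [set zeta | forall eps : R, 0 < eps ->
     \forall z \near zs, F z -> dot zeta (z - zs) <= eps * enorm (z - zs)].

Definition local_minimizer (phi : 'cV[R]_n -> R) F zs : Prop :=
  F zs /\ \forall z \near zs, F z -> phi zs <= phi z.

End Euclidean.

Definition component {R : realType} {n k : nat} (F : 'cV[R]_n -> 'cV[R]_k)
    (i : 'I_k) : 'cV[R]_n -> R := fun z => F z i 0.

Record mpsc (R : realType) (n p q m : nat) := Mpsc {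
  objective : 'cV[R]_n -> R;
  ineq : 'cV[R]_n -> 'cV[R]_p;
  eqc : 'cV[R]_n -> 'cV[R]_q;
  switchG : 'I_m -> 'cV[R]_n -> R;
  switchH : 'I_m -> 'cV[R]_n -> R }.

Record multiplier (R : realType) (p q m : nat) := Multiplier {
  mul_g : 'cV[R]_p;
  mul_h : 'cV[R]_q;
  mul_G : 'cV[R]_m;
  mul_H : 'cV[R]_m }.

Section MPSC.
Context {R : realType} {n p q m : nat} (P : mpsc R n p q m).
Let f := objective P.
Let g := component (ineq P).
Let h := component (eqc P).
Let G := switchG P.
Let H := switchH P.

Definition smooth : Prop :=
  [/\ C1 f, forall i, C1 (g i), forall j, C1 (h j), forall i, C1 (G i)
    & forall i, C1 (H i)].

Definition feasible : set 'cV[R]_n :=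
  [set z | [/\ forall i, g i z <= 0, forall j, h j z = 0
             & forall i, G i z * H i z = 0]].

Variable zs : 'cV[R]_n.

Definition I_g : {set 'I_p} := [set i | g i zs == 0]%SET.
Definition I_G : {set 'I_m} := [set i | (G i zs == 0) && (H i zs != 0)]%SET.
Definition I_H : {set 'I_m} := [set i | (G i zs != 0) && (H i zs == 0)]%SET.
Definition I_GH : {set 'I_m} := [set i | (G i zs == 0) && (H i zs == 0)]%SET.

Definition is_split (b1 b2 : {set 'I_m}) : Prop :=
  (b1 :&: b2 = finset.set0 /\ b1 :|: b2 = I_GH)%SET.

Definition lin_cone : set 'cV[R]_n :=
  [set d | [/\ forall i, i \in I_g -> dot (gradient (g i) zs) d <= 0,
               forall j, dot (gradient (h j) zs) d = 0,
               forall i, i \in I_G -> dot (gradient (G i) zs) d = 0,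
               forall i, i \in I_H -> dot (gradient (H i) zs) d = 0
             & forall i, i \in I_GH ->
                 dot (gradient (G i) zs) d * dot (gradient (H i) zs) d = 0]].

Definition GGCQ : Prop := frechet_normal feasible zs = polar lin_cone.

Definition R_SC : set (multiplier R p q m) :=
  [set mu | [/\ forall i, i \notin I_g -> mul_g mu i 0 = 0,
                forall i, i \in I_H -> mul_G mu i 0 = 0
              & forall i, i \in I_G -> mul_H mu i 0 = 0]].

Definition constraint_comb (mu : multiplier R p q m) : 'cV[R]_n :=
  \sum_(i < p) mul_g mu i 0 *: gradient (g i) zs
  + \sum_(j < q) mul_h mu j 0 *: gradient (h j) zs
  + \sum_(i < m) (mul_G mu i 0 *: gradient (G i) zs
                  + mul_H mu i 0 *: gradient (H i) zs).

Definition N_SC : set (multiplier R p q m) :=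
  [set mu | R_SC mu /\ constraint_comb mu = 0].

Definition Q_stationary (b1 b2 : {set 'I_m}) : Prop :=
  feasible zs /\
  exists la mu : multiplier R p q m,
    [/\ R_SC la /\ gradient f zs + constraint_comb la = 0,
        N_SC mu,
        forall i, i \in I_g -> Num.max (mul_g mu i 0) 0 <= mul_g la i 0,
        forall i, i \in b1 -> mul_H la i 0 = 0 /\ mul_G la i 0 = mul_G mu i 0
      & forall i, i \in b2 -> mul_G la i 0 = 0 /\ mul_H la i 0 = mul_H mu i 0].

Definition S_stationary : Prop :=
  feasible zs /\
  exists la : multiplier R p q m,
    [/\ gradient f zs
          + \sum_(i in I_g) mul_g la i 0 *: gradient (g i) zs
          + \sum_(j < q) mul_h la j 0 *: gradient (h j) zs
          + \sum_(i < m) (mul_G la i 0 *: gradient (G i) zs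
                          + mul_H la i 0 *: gradient (H i) zs) = 0,
        forall i, i \in I_g -> 0 <= mul_g la i 0,
        forall i, i \in I_H -> mul_G la i 0 = 0,
        forall i, i \in I_G -> mul_H la i 0 = 0
      & forall i, i \in I_GH -> mul_G la i 0 = 0 /\ mul_H la i 0 = 0].

End MPSC.

(* Main.v *)
(** By local optimality [- grad f] is a Frechet normal, so under GGCQ it lies in
    the polar of the linearization cone. For a split [(b1, b2)] this cone
    contains the polyhedral cones where the G-gradients vanish on [b1] and the
    H-gradients on [b2], and the same with [b1] and [b2] exchanged. Farkas'
    lemma on both cones gives multipliers [la] and [nu], and Q-stationarity
    holds with [la] and [mu = la - nu]. Conversely, given [la] and [mu], the
    orthogonality relations force [la] or [la - mu] to be an S-multiplier. *)

Require Import Defs.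
From mathcomp Require Import lra.

Local Open Scope classical_set_scope.
Local Open Scope ring_scope.

(** * Inner product and Farkas' lemma *)

Section Dot.
Context {R : realType} {n : nat}.
Implicit Types x y z : 'cV[R]_n.

Lemma dotE x y : dot x y = \sum_i x i 0 * y i 0.
Proof. by rewrite /dot mxE; apply: eq_bigr => i _; rewrite mxE. Qed.

Lemma dotBl x y z : dot (x - y) z = dot x z - dot y z.
Proof. by rewrite /dot linearB /= mulmxBl !mxE. Qed.

Lemma dotBr x y z : dot x (y - z) = dot x y - dot x z.
Proof. by rewrite /dot mulmxBr !mxE. Qed.

Lemma dotNl x y : dot (- x) y = - dot x y.
Proof. by rewrite /dot linearN /= mulNmx mxE. Qed.

Lemma dotZl a x y : dot (a *: x) y = a * dot x y.
Proof. by rewrite /dot linearZ /= -scalemxAl mxE. Qed.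

Lemma dotZr a x y : dot x (a *: y) = a * dot x y.
Proof. by rewrite /dot -scalemxAr mxE. Qed.

Lemma dotxx_ge0 x : 0 <= dot x x.
Proof. by rewrite dotE; apply: sumr_ge0 => i _; rewrite -expr2 sqr_ge0. Qed.

Lemma dotxx_eq0 x : dot x x <= 0 -> x = 0.
Proof.
move=> x_le0; have /eqP : dot x x = 0 by apply/le_anti; rewrite x_le0 dotxx_ge0.
rewrite dotE psumr_eq0 => [/allP x0|i _]; last by rewrite -expr2 sqr_ge0.
apply/matrixP => i j; rewrite ord1 mxE; apply/eqP.
by have := x0 i (mem_index_enum _); rewrite /= mulf_eq0 orbb.
Qed.

(** Differentiability yields estimates in the max norm, while [frechet_normal] is stated with the
    Euclidean one; this inequality passes from the first to the second. *)
Lemma norm_le_enorm x : `|x| <= enorm x.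
Proof.
rewrite [leLHS]/Num.norm /= mx_normrE.
apply: bigmax_le => [|[i j] _ /=]; first exact: sqrtr_ge0.
rewrite ord1 -sqrtr_sqr ler_sqrt ?dotxx_ge0// dotE (bigD1 i)//= expr2 lerDl.
by apply: sumr_ge0 => k _; rewrite -expr2 sqr_ge0.
Qed.

(* Bartl's induction on the number of generators: a direction [x0] witnessing
   that [v i] cannot be dropped is used to project along [x0] onto the kernel
   of [dot (v i)]. *)
Lemma farkas_seq (I : eqType) (s : seq I) (v : I -> 'cV[R]_n) (c : 'cV[R]_n) :
  uniq s ->
  (forall x, (forall i, i \in s -> dot (v i) x <= 0) -> dot c x <= 0) ->
  exists2 a : I -> R, (forall i, 0 <= a i) & c = \sum_(i <- s) a i *: v i.
Proof.
elim: s v c => [|i s IHs] v c /= => [_ c_le0|/andP[iNs us] c_le0].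
  by exists (fun=> 0) => //; rewrite big_nil; apply: dotxx_eq0; exact: c_le0.
have upd (a : I -> R) b : \sum_(j <- i :: s) (if j == i then b else a j) *: v j
    = b *: v i + \sum_(j <- s) a j *: v j.
  rewrite big_cons eqxx; congr (_ + _); apply: eq_big_seq => j js.
  by case: eqP js => // ->; rewrite (negPf iNs).
have [c_s|] := pselect (forall x,
    (forall j, j \in s -> dot (v j) x <= 0) -> dot c x <= 0).
  have [a a_ge0 ->] := IHs v c us c_s.
  exists (fun j => if j == i then 0 else a j) => [j|].
    by case: ifP.
  by rewrite upd scale0r add0r.
move=> /existsNP[x /not_implyP[xs /negP]]; rewrite -ltNge => cx_gt0.
(* Otherwise [x] would satisfy all the inequalities, including that of [i], and contradict
   [c_le0]. *)
have vix_gt0 : 0 < dot (v i) x.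
  rewrite ltNge; apply/negP => vix; move: cx_gt0; rewrite ltNge => /negP; apply.
  by apply: c_le0 => j; rewrite inE => /orP[/eqP ->|/xs].
pose x0 := (dot (v i) x)^-1 *: x.
have vix0 : dot (v i) x0 = 1 by rewrite dotZr mulVf // gt_eqF.
have x0s j : j \in s -> dot (v j) x0 <= 0.
  by move=> /xs vjx; rewrite dotZr mulr_ge0_le0 // invr_ge0 ltW.
have cx0_ge0 : 0 <= dot c x0.
  by rewrite dotZr; apply: mulr_ge0; rewrite ?invr_ge0; exact: ltW.
(* [proj] is the adjoint of the projection along [x0]. Projected test vectors are orthogonal to
   [v i], so [c_le0] applies to them. *)
pose proj w := w - dot w x0 *: v i.
have projE w y : dot (proj w) y = dot w (y - dot (v i) y *: x0).
  by rewrite dotBl dotZl dotBr (dotZr (dot (v i) y)) mulrC.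
have [y ys|a a_ge0 cE] := IHs (proj \o v) (proj c) us.
  rewrite projE; apply: c_le0 => j; rewrite inE => /orP[/eqP ->|/ys].
    by rewrite dotBr (dotZr (dot (v i) y)) vix0 mulr1 subrr.
  by rewrite /= projE.
(* This coefficient of [v i] is what remains after expanding [proj c] in the vectors [proj (v j)];
   it is nonnegative because [x0s] makes the subtracted sum nonpositive. *)
pose b := dot c x0 - \sum_(j <- s) a j * dot (v j) x0.
exists (fun j => if j == i then b else a j) => [j|].
  case: ifP => // _; rewrite subr_ge0 (le_trans _ cx0_ge0) // big_seq.
  by apply: sumr_le0 => k /x0s; apply: mulr_ge0_le0.
rewrite upd scalerBl scaler_suml -[LHS](subrK (dot c x0 *: v i)) -/(proj c) cE.
rewrite [RHS]addrAC [X in X - _]addrC [RHS]addrAC; congr (_ + _).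
by rewrite -sumrB; apply: eq_bigr => j _; rewrite /= scalerBr scalerA.
Qed.

(** Each equality is split into two opposite inequalities, whose coefficients are subtracted at the
    end. Indices outside [A] or [B] get the zero generator, so their coefficients can be reset to
    0. *)
Lemma farkas (I J : finType) (A : {pred I}) (B : {pred J})
    (v : I -> 'cV[R]_n) (w : J -> 'cV[R]_n) (c : 'cV[R]_n) :
  (forall x, (forall i, i \in A -> dot (v i) x <= 0) ->
             (forall j, j \in B -> dot (w j) x = 0) -> dot c x <= 0) ->
  exists (a : I -> R) (b : J -> R),
    [/\ forall i, 0 <= a i, forall i, i \notin A -> a i = 0,
        forall j, j \notin B -> b j = 0
      & c = \sum_i a i *: v i + \sum_j b j *: w j].
Proof.
move=> c_le0.
pose u (k : I + (J + J)) := match k with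
  | inl i => if i \in A then v i else 0
  | inr (inl j) => if j \in B then w j else 0
  | inr (inr j) => if j \in B then - w j else 0 end.
have [x xu|a a_ge0 cE] := @farkas_seq _ (index_enum _) u c (index_enum_uniq _).
  have {}xu k : dot (u k) x <= 0 by apply: xu; rewrite mem_index_enum.
  apply: c_le0 => [i iA|j jB]; first by have := xu (inl i); rewrite /= iA.
  have := xu (inr (inl j)); have := xu (inr (inr j)).
  by rewrite /= jB dotNl oppr_le0 => ? ?; apply/le_anti/andP.
exists (fun i => if i \in A then a (inl i) else 0).
exists (fun j => if j \in B then a (inr (inl j)) - a (inr (inr j)) else 0).
split=> [i|i /negPf -> //|j /negPf -> //|]; first by case: ifP.
rewrite cE !big_sumType /= -big_split /=; congr (_ + _).
  by apply: eq_bigr => i _; case: ifP => _; rewrite ?scaler0 ?scale0r.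
apply: eq_bigr => j _; case: ifP => _; rewrite ?scaler0 ?scale0r ?addr0 //.
by rewrite scalerBl scalerN.
Qed.

End Dot.

(** * First-order necessary condition at a local minimizer *)

Section Fermat.
Context {R : realType} {n : nat}.
Implicit Types (phi : 'cV[R]_n -> R) (z v : 'cV[R]_n).

Lemma diff_gradient phi z v : differentiable phi z ->
  'd phi z v = dot (gradient phi z) v.
Proof.
move=> dphi; rewrite dotE {1}[v]matrix_sum_delta linear_sum /=.
apply: eq_bigr => i _; rewrite big_ord1 linearZ /= -deriveE // mxE.
by rewrite mulrC.
Qed.

(** On [F] near [z] the increment of [phi] is nonnegative, so its linear part is at least minus the
    remainder of the first-order expansion. *)
Lemma local_minimizer_normal phi (F : set 'cV[R]_n) z :
  differentiable phi z -> local_minimizer phi F z ->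
  frechet_normal F z (- gradient phi z).
Proof.
move=> dphi [_ zmin] eps eps_gt0.
have /eqaddoP/(_ eps eps_gt0) small := diff_locally dphi.
have {}small : \forall y \near z, `|phi y - (phi z + 'd phi z (y - z))|
    <= eps * `|y - z|.
  rewrite (near_shift 0); apply: filterS small => w.
  by rewrite /= !fctE /= subr0 addrK.
near=> y => Fy.
have phi_ge : phi z <= phi y by move: Fy; near: y.
have : `|phi y - (phi z + 'd phi z (y - z))| <= eps * `|y - z| by near: y.
have := ler_wpM2l (ltW eps_gt0) (norm_le_enorm (y - z)).
rewrite dotNl -diff_gradient // => le_e /(le_trans (ler_norm _)) ?.
lra.
Unshelve. all: by end_near.
Qed.

End Fermat.

(** * Multipliers and the two stationarity implications *)

Section Multipliers.
Context {R : realType} {n p q m : nat} (P : mpsc R n p q m).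
Variable zs : 'cV[R]_n.
Implicit Types la mu : multiplier R p q m.

Definition multiplier_sub la mu := Multiplier (mul_g la - mul_g mu)
  (mul_h la - mul_h mu) (mul_G la - mul_G mu) (mul_H la - mul_H mu).

Lemma R_SC_sub la mu : R_SC P zs la -> R_SC P zs mu ->
  R_SC P zs (multiplier_sub la mu).
Proof.
move=> [lag laG laH] [mug muG muH]; split=> i iI; rewrite !mxE.
- by rewrite lag // mug // subrr.
- by rewrite laG // muG // subrr.
- by rewrite laH // muH // subrr.
Qed.

Lemma constraint_comb_sub la mu :
  constraint_comb P zs (multiplier_sub la mu)
  = constraint_comb P zs la - constraint_comb P zs mu.
Proof.
have E k (x y : 'cV[R]_k) (u : 'I_k -> 'cV[R]_n) :
    \sum_i (x - y) i 0 *: u i = \sum_i x i 0 *: u i - \sum_i y i 0 *: u i.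
  by rewrite -sumrB; apply: eq_bigr => i _; rewrite !mxE scalerBl.
rewrite /constraint_comb !big_split /= !E 2!(addrACA _ (- _)) -!opprD.
by rewrite [LHS]addrACA -opprD.
Qed.

(** Farkas' lemma is applied to the polyhedral subcone attached to the split. The G-gradients enter
    it only on [I_G] and [b1], the H-gradients only on [I_H] and [b2]; all other switching
    multipliers vanish. *)
Lemma polar_lin_cone_multiplier (b1 b2 : {set 'I_m}) (c : 'cV[R]_n) :
  is_split P zs b1 b2 -> polar (lin_cone P zs) (- c) ->
  exists la, [/\ R_SC P zs la, c + constraint_comb P zs la = 0,
    forall i, 0 <= mul_g la i 0,
    forall i, i \in b1 -> mul_H la i 0 = 0
    & forall i, i \in b2 -> mul_G la i 0 = 0].
Proof.
move=> [b12_disj b12_cover] c_polar.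
pose B (k : 'I_q + ('I_m + 'I_m)) := match k with
  | inl _ => true
  | inr (inl i) => i \in (I_G P zs :|: b1)%SET
  | inr (inr i) => i \in (I_H P zs :|: b2)%SET end.
pose w (k : 'I_q + ('I_m + 'I_m)) := match k with
  | inl j => gradient (component (eqc P) j) zs
  | inr (inl i) => gradient (switchG P i) zs
  | inr (inr i) => gradient (switchH P i) zs end.
have [x xg xw|a [b [a_ge0 a0 b0 cE]]] :=
  @farkas _ _ _ _ (mem (I_g P zs)) B
    (fun i => gradient (component (ineq P) i) zs) w (- c).
  apply: c_polar; split=> [i /xg //|j|i iG|i iH|i].
  - exact: (xw (inl j)).
  - by apply: (xw (inr (inl i))); rewrite unfold_in /= inE iG.
  - by apply: (xw (inr (inr i))); rewrite unfold_in /= inE iH.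
  - rewrite -b12_cover inE => /orP[ib|ib].
    + by rewrite (xw (inr (inl i))) ?mul0r // unfold_in /= inE ib orbT.
    + by rewrite (xw (inr (inr i))) ?mulr0 // unfold_in /= inE ib orbT.
have b1b2F i : i \in b1 -> i \in b2 -> False.
  by move=> i1 i2; move/setP/(_ i): b12_disj; rewrite !inE i1 i2.
have bGH i : (i \in b1) || (i \in b2) ->
    (switchG P i zs == 0) && (switchH P i zs == 0).
  by rewrite -finset.in_setU b12_cover inE.
exists (Multiplier (\col_i a i) (\col_j b (inl j))
  (\col_i b (inr (inl i))) (\col_i b (inr (inr i)))).
split=> [|||i ib|i ib] /=.
- split=> i /= iI; rewrite mxE.
  + exact: a0.
  (* An index of [I_H] has nonzero G-value, hence lies neither in [I_G] nor in [b1], which is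
     contained in [I_GH]. *)
  + apply: b0; rewrite unfold_in /= !inE; move: iI; rewrite inE => /andP[/negPf G0 H0].
    rewrite G0 /=; apply/negP => ib; have := bGH i; rewrite ib G0.
    by move=> /(_ isT).
  + apply: b0; rewrite unfold_in /= !inE; move: iI; rewrite inE => /andP[G0 /negPf H0].
    rewrite H0 andbF /=; apply/negP => ib; have := bGH i; rewrite ib orbT H0.
    by move=> /(_ isT); rewrite andbF.
- apply/eqP; rewrite addrC addr_eq0 cE !big_sumType /= -big_split /= addrA.
  rewrite /constraint_comb /=; apply/eqP.
  by congr (_ + _ + _); apply: eq_bigr => i _; rewrite !mxE.
- by move=> i; rewrite mxE.
- rewrite mxE; apply: b0; rewrite unfold_in /= !inE negb_or; apply/andP; split.
    have /andP[/eqP -> _] := bGH i (introT orP (or_introl ib)).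
    by rewrite eqxx.
  by apply/negP => /(b1b2F i ib).
- rewrite mxE; apply: b0; rewrite unfold_in /= !inE negb_or; apply/andP; split.
    have /andP[_ /eqP ->] := bGH i (introT orP (or_intror ib)).
    by rewrite eqxx andbF.
  by apply/negP => /b1b2F; apply.
Qed.

Lemma S_stationaryP la : feasible P zs -> R_SC P zs la ->
  gradient (objective P) zs + constraint_comb P zs la = 0 ->
  (forall i, i \in I_g P zs -> 0 <= mul_g la i 0) ->
  (forall i, i \in I_GH P zs -> mul_G la i 0 = 0 /\ mul_H la i 0 = 0) ->
  S_stationary P zs.
Proof.
move=> feas [lag laG laH] la0 lag_ge0 laGH; split=> //; exists la; split=> //.
apply: etrans la0; rewrite /constraint_comb !addrA; congr (_ + _ + _ + _).
rewrite [RHS](bigID (mem (I_g P zs))) /= [X in _ + X]big1 ?addr0 // => i /lag ->.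
by rewrite scale0r.
Qed.

Lemma is_splitC b1 b2 : is_split P zs b1 b2 -> is_split P zs b2 b1.
Proof.
by case=> *; split; rewrite ?(finset.setIC b2) ?(finset.setUC b2).
Qed.

Lemma GGCQ_Q_stationary b1 b2 : differentiable (objective P) zs ->
  local_minimizer (objective P) (feasible P) zs -> GGCQ P zs ->
  is_split P zs b1 b2 -> Q_stationary P zs b1 b2.
Proof.
move=> df zmin ggcq b12; split; first by case: zmin.
have := local_minimizer_normal _ _ _ df zmin; rewrite ggcq => f_polar.
have [la [laR la0 lag laH laG]] := polar_lin_cone_multiplier _ _ _ b12 f_polar.
have [nu [nuR nu0 nug nuH nuG]] :=
  polar_lin_cone_multiplier _ _ _ (is_splitC _ _ b12) f_polar.
exists la, (multiplier_sub la nu); split.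
- by [].
- split; first exact: R_SC_sub.
  rewrite constraint_comb_sub; apply/eqP; rewrite subr_eq0; apply/eqP.
  by apply: (addrI (gradient (objective P) zs)); rewrite la0 nu0.
(* Both signs matter: [la] gives the bound by 0, [nu] the bound by the entry of [la - nu]. Below,
   [nu] comes from the exchanged split, so its G-part vanishes on [b1] and its H-part on [b2]. *)
- by move=> i _; rewrite ge_max !mxE lag gerBl nug.
- by move=> i ib; rewrite laH // !mxE nuG // subr0.
- by move=> i ib; rewrite laG // !mxE nuH // subr0.
Qed.

(* If [mu] vanishes on [mul_G, b1] and [mul_H, b2] then [la] is the required
   multiplier; otherwise the orthogonality relations make [mu] vanish on
   [mul_H, b1] and [mul_G, b2], and [la - mu] is. *)
Lemma Q_stationary_S_stationary b1 b2 :
  is_split P zs b1 b2 -> Q_stationary P zs b1 b2 ->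
  (forall mu, N_SC P zs mu ->
    [/\ forall i i', i \in b1 -> i' \in b2 ->
          mul_G mu i 0 * mul_G mu i' 0 = 0
          /\ mul_H mu i 0 * mul_H mu i' 0 = 0,
        forall i i', i \in b1 -> i' \in b1 ->
          mul_G mu i 0 * mul_H mu i' 0 = 0
      & forall i i', i \in b2 -> i' \in b2 ->
          mul_G mu i 0 * mul_H mu i' 0 = 0]) ->
  S_stationary P zs.
Proof.
move=> [_ cover] [feas [la [mu [[laR la0] muN lag lab1 lab2]]]] orth.
have [orth12 orth11 orth22] := orth mu muN.
have mul0 (x y : R) : x * y = 0 -> x != 0 -> y = 0.
  by move=> /eqP; rewrite mulf_eq0 => /orP[/eqP ->|/eqP //]; rewrite eqxx.
have [mu_S|mu_S] := pselect ((forall i, i \in b1 -> mul_G mu i 0 = 0) /\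
                     (forall i, i \in b2 -> mul_H mu i 0 = 0)).
  apply: (S_stationaryP _ feas laR la0) => i.
    by move=> /lag; rewrite ge_max => /andP[].
  rewrite -cover inE => /orP[ib|ib].
  - by have [-> ->] := lab1 i ib; rewrite mu_S.1.
  - by have [-> ->] := lab2 i ib; rewrite mu_S.2.
have [mu1 mu2] : (forall i, i \in b1 -> mul_H mu i 0 = 0) /\
                 (forall i, i \in b2 -> mul_G mu i 0 = 0).
  (* One nonzero entry suffices: paired with it, the relation inside its own block kills one family
     and the relation across blocks the other. *)
  move/not_andP : mu_S => [] /existsNP[i /not_implyP[ib /eqP mui]].
  - split=> k kb; last exact: mul0 (orth12 i k ib kb).1 mui.
    exact: mul0 (orth11 i k ib kb) mui.
  - split=> k kb; apply: mul0 mui; rewrite mulrC; last exact: orth22.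
    exact: (orth12 k i kb ib).2.
have [muR mu0] := muN.
apply: (S_stationaryP (multiplier_sub la mu) feas) => [|||i].
- exact: R_SC_sub.
- by rewrite constraint_comb_sub mu0 subr0.
(* The entry of [mu] inside the maximum is used here; the case of [la] used the 0. *)
- by move=> i /lag; rewrite ge_max !mxE subr_ge0 => /andP[].
- rewrite -cover inE !mxE => /orP[ib|ib].
  + by have [-> ->] := lab1 i ib; rewrite mu1 // !subrr.
  + by have [-> ->] := lab2 i ib; rewrite mu2 // !subrr.
Qed.

End Multipliers.

Theorem proposition4p1 (R : realType) (n p q m : nat) (P : mpsc R n p q m)
    (zs : 'cV[R]_n) (hP : smooth P)
    (hzs : local_minimizer (objective P) (feasible P) zs) :
  (GGCQ P zs ->
     forall b1 b2 : {set 'I_m}, is_split P zs b1 b2 -> Q_stationary P zs b1 b2)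
  /\
  ((exists b1 b2 : {set 'I_m},
      [/\ is_split P zs b1 b2,
          Q_stationary P zs b1 b2
        & forall mu : multiplier R p q m, N_SC P zs mu ->
            [/\ forall i i', i \in b1 -> i' \in b2 ->
                  mul_G mu i 0 * mul_G mu i' 0 = 0
                  /\ mul_H mu i 0 * mul_H mu i' 0 = 0,
                forall i i', i \in b1 -> i' \in b1 ->
                  mul_G mu i 0 * mul_H mu i' 0 = 0
              & forall i i', i \in b2 -> i' \in b2 ->
                  mul_G mu i 0 * mul_H mu i' 0 = 0]]) ->
   S_stationary P zs).
Proof.
split=> [ggcq b1 b2 b12|[b1 [b2 [b12 Qst orth]]]].
  by case: hP => -[df _] _ _ _ _; exact: GGCQ_Q_stationary.
exact: Q_stationary_S_stationary b12 Qst orth.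
Qed.
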